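(* Let $(R,\mathfrak{m})$ be a local (resp. gr-local) Noetherian ring. Let $I\subseteq R$ be an ideal (resp. a homogeneous ideal) with $(I:\mathfrak{m})\neq I$. Then there exist ideals (resp. homogeneous ideals) $J,H$ such that $H$ is $\mathfrak{m}$-primary, $I=J\cap H$, $(J:\mathfrak{m})=J$, and the natural map $$u:\frac{(I:\mathfrak{m})}{I}\to\frac{(H:\mathfrak{m})}{H},\qquad f+I\mapsto f+H,$$ is an isomorphism. Moreover, there is only one such choice of $J$, namely $J=(I:\mathfrak{m}^\infty)$, and the set of ideals $H$ that fulfill the conditions forms an antichain with respect to inclusion.
   Context: Rings are commutative with $1$. Let $\Gamma=\mathbb{Z}$ or $\Gamma=\mathbb{Z}^d$ for some $d\in\mathbb{N}$. A gr-local (graded local) ring is a $\Gamma$-graded ring $R$ such that the ideal $\mathfrak{m}$ generated by the homogeneous nonunits of $R$ satisfies $\mathfrak{m}\neq R$; one then writes $(R,\mathfrak{m})$. ''Homogeneous'' refers to the $\Gamma$-grading. The statement has two versions: a local one (with ordinary ideals) and a gr-local one (with homogeneous ideals throughout). The ideal $(I:\mathfrak{m}^\infty)$ is $\bigcup_{n\in\mathbb{N}}(I:\mathfrak{m}^n)$. The ideal $J$ is allowed to be $R$. *)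

(* Defs.v *)
From HB Require Import structures.
From mathcomp Require Import all_boot all_order all_algebra.
From mathcomp Require Import generic_quotient ring_quotient.
From mathcomp Require Import boolp classical_sets.

Set Implicit Arguments.
Unset Strict Implicit.
Unset Printing Implicit Defensive.

Import GRing.Theory.
Local Open Scope ring_scope.
Local Open Scope classical_set_scope.
Local Open Scope quotient_scope.

(* [idealr] of ring_quotient only covers proper ideals, whereas the unit ideal
   has to be allowed here. *)
Record ideal (R : comNzRingType) := Ideal {
  ideal_set :> set R;
  ideal_0 : ideal_set 0;
  ideal_add : forall x y, ideal_set x -> ideal_set y -> ideal_set (x + y);
  ideal_mul : forall a x, ideal_set x -> ideal_set (a * x)
}.

Section Ideals.
Variable R : comNzRingType.
Implicit Types (S : set R) (I J K m : ideal R).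

Program Definition unit_ideal : ideal R := @Ideal R setT _ _ _.

Program Definition gen S : ideal R :=
  @Ideal R [set x | forall K : ideal R, S `<=` K -> ideal_set K x] _ _ _.
Next Obligation. exact: ideal_0. Qed.
Next Obligation. by apply: ideal_add; [exact: H|exact: H0]. Qed.
Next Obligation. by apply: ideal_mul; exact: H. Qed.

Definition prod_ideal I J : ideal R :=
  gen [set z | exists x y, [/\ ideal_set I x, ideal_set J y & z = x * y]].

Fixpoint pow_ideal I (n : nat) : ideal R :=
  if n is n'.+1 then prod_ideal I (pow_ideal I n') else unit_ideal.

Program Definition colon I K : ideal R :=
  @Ideal R [set f | forall g, ideal_set K g -> ideal_set I (f * g)] _ _ _.
Next Obligation. by rewrite mul0r; exact: ideal_0. Qed.
Next Obligation. by rewrite mulrDl; apply: ideal_add; [exact: H|exact: H0]. Qed.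
Next Obligation. by rewrite -mulrA; apply: ideal_mul; exact: H. Qed.

(* (I : K^oo) *)
Definition saturation I K : set R :=
  \bigcup_(n in [set: nat]) colon I (pow_ideal K n).

Definition radical I : set R := [set x | exists n : nat, ideal_set I (x ^+ n)].

Definition noetherian : Prop :=
  forall I, exists s : seq R, I = gen [set x | x \in s] :> set R.

Definition maximal_ideal m : Prop :=
  ~ ideal_set m 1 /\ forall K, m `<=` K -> K = m :> set R \/ ideal_set K 1.

Definition is_local m : Prop :=
  maximal_ideal m /\ forall K, maximal_ideal K -> K = m :> set R.

Definition primary H : Prop :=
  ~ ideal_set H 1 /\
  forall x y, ideal_set H (x * y) -> ideal_set H x \/ radical H y.

Definition primary_to m H : Prop := primary H /\ radical H = m.

Definition is_unit (x : R) : Prop := exists y, x * y = 1.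

End Ideals.

Record grading (G : zmodType) (R : comNzRingType) := Grading {
  piece :> G -> set R;
  piece_0 : forall g, piece g 0;
  piece_sub : forall g x y, piece g x -> piece g y -> piece g (x - y);
  piece_mul : forall g h x y,
    piece g x -> piece h y -> piece (g + h) (x * y);
  grading_span : forall x, exists (s : seq G) (c : G -> R),
    [/\ uniq s, (forall g, piece g (c g)) & x = \sum_(g <- s) c g];
  grading_indep : forall (s : seq G) (c : G -> R),
    uniq s -> (forall g, piece g (c g)) -> \sum_(g <- s) c g = 0 ->
    forall g, g \in s -> c g = 0
}.

Section Graded.
Variables (G : zmodType) (R : comNzRingType) (A : grading G R).

Definition homogeneous : set R := \bigcup_(g in [set: G]) A g.

Definition homogeneous_ideal (I : ideal R) : Prop :=
  exists2 S : set R, S `<=` homogeneous & I = gen S :> set R.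

Definition is_gr_local (m : ideal R) : Prop :=
  m = gen [set x | homogeneous x /\ ~ is_unit x] :> set R /\ ~ ideal_set m 1.

End Graded.

Section IdealQuotient.
Variable R : comNzRingType.

Definition ideal_pred (N : ideal R) : {pred R^o} := fun x => `[< ideal_set N x >].

Lemma ideal_pred_closed (N : ideal R) : submod_closed (ideal_pred N).
Proof.
split; first by apply/asboolP; exact: ideal_0.
move=> a x y /asboolP Nx /asboolP Ny; apply/asboolP.
by apply: ideal_add => //; exact: ideal_mul.
Qed.
HB.instance Definition _ (N : ideal R) :=
  GRing.isSubmodClosed.Build R R^o (ideal_pred N) (ideal_pred_closed N).

Definition ideal_module (N : ideal R) : Type := {x : R^o | x \in ideal_pred N}.
HB.instance Definition _ (N : ideal R) := Choice.on (ideal_module N).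
HB.instance Definition _ (N : ideal R) := SubType.on (ideal_module N).
HB.instance Definition _ (N : ideal R) :=
  [SubChoice_isSubLmodule of ideal_module N by <:].

Section Quotient.
Variables N I : ideal R.

Definition trace_pred : {pred ideal_module N} := fun x => val x \in ideal_pred I.

Lemma trace_pred_closed : submod_closed trace_pred.
Proof.
split; first by rewrite unfold_in raddf0 rpred0.
by move=> a x y xI yI; rewrite unfold_in linearP rpredD ?rpredZ.
Qed.
HB.instance Definition _ :=
  GRing.isSubmodClosed.Build R (ideal_module N) trace_pred trace_pred_closed.

(* The R-module N / (N `&` I), which is N / I as soon as I `<=` N. *)
Definition iquot : Type := Quotient.quot trace_pred.
HB.instance Definition _ := GRing.Zmodule.on iquot.

Definition iclass (v : ideal_module N) : iquot :=
  \pi_(Quotient.quot trace_pred) v.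
Definition qscale (a : R) (q : iquot) : iquot :=
  iclass (a *: repr (q : Quotient.quot trace_pred)).

Lemma iclassP (v w : ideal_module N) :
  iclass v = iclass w <-> v - w \in trace_pred.
Proof.
by rewrite Quotient.idealrBE; split=> [/eqP|/eqP].
Qed.

Lemma iclassD : {morph iclass : v w / v + w}.
Proof. by move=> v w; rewrite /iclass !piE. Qed.

Lemma iclass_surj (q : iquot) : exists v, q = iclass v.
Proof. by exists (repr (q : Quotient.quot trace_pred)); rewrite /iclass reprK. Qed.

Lemma iclassZ a v : qscale a (iclass v) = iclass (a *: v).
Proof.
apply/iclassP; rewrite -scalerBr rpredZ //; apply/iclassP.
by rewrite /iclass reprK.
Qed.

Lemma qscaleA a b q : qscale a (qscale b q) = qscale (a * b) q.
Proof. by have [v ->] := iclass_surj q; rewrite !iclassZ scalerA. Qed.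

Lemma qscale1 : left_id 1 qscale.
Proof. by move=> q; have [v ->] := iclass_surj q; rewrite iclassZ scale1r. Qed.

Lemma qscaleDr : right_distributive qscale +%R.
Proof.
move=> a p q; have [v ->] := iclass_surj p; have [w ->] := iclass_surj q.
by rewrite -iclassD !iclassZ -iclassD scalerDr.
Qed.

Lemma qscaleDl q : {morph qscale^~ q : a b / a + b}.
Proof.
by move=> a b; have [v ->] := iclass_surj q; rewrite !iclassZ -iclassD scalerDl.
Qed.

HB.instance Definition _ := GRing.Zmodule_isLmodule.Build R iquot
  qscaleA qscale1 qscaleDr qscaleDl.

End Quotient.

(* f + I |-> f + H is an isomorphism of R-modules (I : m) / I -> (H : m) / H *)
Definition natural_iso (m I H : ideal R) : Prop :=
  exists u : {linear iquot (colon I m) I -> iquot (colon H m) H},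
    (forall f : ideal_module (colon I m),
       exists f' : ideal_module (colon H m),
         val f' = val f /\ u (iclass I f) = iclass H f')
    /\ bijective u.

(* [P] is the class of admissible ideals: all of them, or the homogeneous ones. *)
Definition good_pair (P : ideal R -> Prop) (m I J H : ideal R) : Prop :=
  (P J /\ P H) /\
  [/\ primary_to m H, I = J `&` H :> set R, colon J m = J :> set R
    & natural_iso m I H].

Definition good_decomposition (P : ideal R -> Prop) (m I : ideal R) : Prop :=
  [/\ exists J H, good_pair P m I J H,
      forall J H, good_pair P m I J H -> J = saturation I m :> set R
    & forall J1 H1 J2 H2, good_pair P m I J1 H1 -> good_pair P m I J2 H2 ->
        H1 `<=` H2 -> H1 = H2 :> set R].

End IdealQuotient.

(* Main.v *)
(* Take J = (I : m^oo) = (I : m^N) and H maximal among the homogeneous ideals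
   containing I and meeting J in I.  Noether's stabilisation argument shows that
   m lies in the radical of H, so H is m-primary.  If f is homogeneous in
   (H : m) but not in H, maximality gives a homogeneous h + b f in J outside I;
   here b is not in m since m f lies in H, so b is a unit and f is congruent
   modulo H to an element of (I : m).
   Conversely, if J and H are admissible, then powers of elements of m send J
   into I, which forces J = (I : m^oo); and if H1 is strictly contained in H2,
   some f in H2 outside H1 lies in (H1 : m), hence is congruent modulo H1 to an
   element of (I : m), which lies in J and H2, so in I.
   The local case is the gr-local case of the trivial Z-grading.  The gradings
   enter only through a total order on the group of degrees. *)
Require Import Defs.
From HB Require Import structures.
From mathcomp Require Import all_boot all_order all_algebra.
From mathcomp Require Import boolp classical_sets.
From mathcomp Require Import ring.

Set Implicit Arguments.
Unset Strict Implicit.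
Unset Printing Implicit Defensive.

Import Order.TTheory GRing.Theory Num.Theory.
Local Open Scope ring_scope.
Local Open Scope classical_set_scope.

#[local] Identity Coercion fun_of_set : set >-> Funclass.

(** * Colon ideals, powers and radicals *)

Section IdealTheory.
Variable R : comNzRingType.
Implicit Types (I J K L H m : ideal R) (x y z f : R).

Lemma idealN I x : I x -> I (- x).
Proof. by move=> Ix; rewrite -mulN1r; exact: ideal_mul. Qed.

Lemma idealB I x y : I x -> I y -> I (x - y).
Proof. by move=> Ix Iy; apply: ideal_add => //; exact: idealN. Qed.

Lemma ideal_mulr I x a : I x -> I (x * a).
Proof. by rewrite mulrC; exact: ideal_mul. Qed.

Lemma ideal_sum I (T : Type) (r : seq T) (P : pred T) (F : T -> R) :
  (forall i, P i -> I (F i)) -> I (\sum_(i <- r | P i) F i).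
Proof. by move=> IF; apply: big_ind => //; [exact: ideal_0|exact: ideal_add]. Qed.

Lemma sub_gen (S : set R) : S `<=` gen S.
Proof. by move=> x Sx K; exact. Qed.

Lemma gen_sub (S : set R) K : S `<=` K -> gen S `<=` K.
Proof. by move=> SK x; exact. Qed.

(** The elements that [f] multiplies into [I] form an ideal, so generators suffice. *)
Lemma colon_gen I (S : set R) f : (forall x, S x -> I (f * x)) ->
  forall x, gen S x -> I (f * x).
Proof.
move=> fS.
pose K := @Ideal R [set x | I (f * x)]
  ltac:(by rewrite /= mulr0; exact: ideal_0)
  ltac:(by move=> x y /= Ix Iy; rewrite mulrDr; exact: ideal_add)
  ltac:(by move=> a x /= Ix; rewrite mulrCA; exact: ideal_mul).
exact: (@gen_sub S K).
Qed.

Lemma sub_colon I K : I `<=` colon I K.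
Proof. by move=> f If g _; exact: ideal_mulr. Qed.

Lemma colon_mono I J K : I `<=` J -> colon I K `<=` colon J K.
Proof. by move=> IJ f fK g /fK /IJ. Qed.

Lemma colon_prod I K L : colon I (prod_ideal K L) = colon (colon I L) K :> set R.
Proof.
rewrite eqEsubset; split=> [f fKL x Kx y Ly|f fKL].
  by rewrite -mulrA; apply: fKL; apply: sub_gen; exists x, y.
apply: colon_gen => _ [x [y [Kx Ly ->]]].
by rewrite mulrA; exact: fKL.
Qed.

Lemma colon_pow0 I K : colon I (pow_ideal K 0) = I :> set R.
Proof.
rewrite eqEsubset; split; last exact: sub_colon.
by move=> f /(_ 1 Logic.I); rewrite mulr1.
Qed.

Lemma colon_powS I K n :
  colon I (pow_ideal K n.+1) = colon (colon I (pow_ideal K n)) K :> set R.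
Proof. exact: colon_prod. Qed.

Lemma pow_ideal_exp K x n : K x -> pow_ideal K n (x ^+ n).
Proof.
move=> Kx; elim: n => [//|n IHn].
by rewrite exprS; apply: sub_gen; exists x, (x ^+ n).
Qed.

Lemma colon_pow_mono I K n p : (n <= p)%N ->
  colon I (pow_ideal K n) `<=` colon I (pow_ideal K p).
Proof.
move=> /subnK <-; elim: (p - n)%N => [//|k IHk].
by rewrite addSn colon_powS => f /IHk; exact: sub_colon.
Qed.

Lemma ideal_exp_le I x n p : (n <= p)%N -> I (x ^+ n) -> I (x ^+ p).
Proof. by move=> /subnK <- Ix; rewrite exprD; exact: ideal_mul. Qed.

Lemma radical_add I x y : radical I x -> radical I y -> radical I (x + y).
Proof.
move=> [a Ixa] [b Iyb]; exists (a + b)%N; rewrite exprDn.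
apply: ideal_sum => i _; rewrite -mulr_natr; apply: ideal_mulr.
(* In the term of index [i], either [y] has exponent at least [b], or [x] has exponent [a + b - i],
   which is at least [a]. *)
have [bi|ib] := leqP b i; first by apply: ideal_mul; exact: ideal_exp_le Iyb.
apply: ideal_mulr; apply: ideal_exp_le Ixa.
by rewrite leq_subRL ?leq_add2r 1?addnC ?leq_add2l ltnW // ltn_addl.
Qed.

Lemma radical_mul I a x : radical I x -> radical I (a * x).
Proof. by move=> [n Ixn]; exists n; rewrite exprMn; exact: ideal_mul. Qed.

Definition radical_ideal I : ideal R :=
  @Ideal R (radical I) (ex_intro _ 1%N (ideal_0 I)) (@radical_add I) (@radical_mul I).

#[local] Obligation Tactic := idtac.

Program Definition add_elt I z : ideal R :=
  @Ideal R [set x | exists h a, I h /\ x = h + a * z] _ _ _.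
Next Obligation.
by move=> I z; exists 0, 0; split; [exact: ideal_0|rewrite mul0r addr0].
Qed.
Next Obligation.
move=> I z _ _ [h [a [Ih ->]]] [k [b [Ik ->]]].
exists (h + k), (a + b); split; first exact: ideal_add.
by rewrite mulrDl addrACA.
Qed.
Next Obligation.
move=> I z c _ [h [a [Ih ->]]].
by exists (c * h), (c * a); split; [exact: ideal_mul|rewrite mulrDr mulrA].
Qed.

Lemma sub_add_elt I z : I `<=` add_elt I z.
Proof. by move=> x Ix; exists x, 0; rewrite mul0r addr0. Qed.

Lemma mem_add_elt I z : add_elt I z z.
Proof. by exists 0, 1; rewrite mul1r add0r; split=> //; exact: ideal_0. Qed.

Program Definition colon_elt I z : ideal R := @Ideal R [set f | I (f * z)] _ _ _.
Next Obligation. by move=> I z; rewrite /= mul0r; exact: ideal_0. Qed.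
Next Obligation.
by move=> I z x y /= Ix Iy; rewrite mulrDl; exact: ideal_add.
Qed.
Next Obligation.
by move=> I z a x /= Ix; rewrite -mulrA; exact: ideal_mul.
Qed.

(* The witness is [f] times a maximal monomial in the generators that keeps it
   outside [L]. *)
Lemma annihilated_multiple L (s : seq R) f : ~ L f ->
  (forall x, x \in s -> exists n, L (f * x ^+ n)) ->
  exists2 a, ~ L (a * f) & forall x, x \in s -> L (a * f * x).
Proof.
move=> Lf; elim: s => [|x s IHs] powL; first by exists 1; rewrite ?mul1r.
have [|a Laf aL] := IHs.
  by move=> y ys; apply: powL; rewrite inE ys orbT.
have [n Lxn] := powL x (mem_head _ _).
have /ex_minnP[[|k]] : exists n, `[< L (a * f * x ^+ n) >].
- by exists n; apply/asboolP; rewrite -mulrA; exact: ideal_mul.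
- by rewrite expr0 mulr1 => /asboolP.
- move=> /asboolP Lk mink; exists (x ^+ k * a).
    move=> Lka; have /mink : `[< L (a * f * x ^+ k) >].
      by apply/asboolP; rewrite mulrC mulrA.
    by rewrite ltnn.
  move=> y; rewrite inE => /orP[/eqP ->|ys].
    by have -> : x ^+ k * a * f * x = a * f * x ^+ k.+1 by rewrite exprS; ring.
  by rewrite -!mulrA; apply: ideal_mul; rewrite !mulrA; exact: aL.
Qed.

(** * Chain conditions, socle elements and the saturation *)

Section Noetherian.
Hypothesis R_noetherian : noetherian R.

(** The union of the chain is an ideal, and its finitely many generators already lie in one
    stage. *)
Lemma noetherian_acc (C : nat -> ideal R) : (forall n, C n `<=` C n.+1) ->
  exists N, forall n, C n `<=` C N.
Proof.
move=> Cincr.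
have Cmono n p : (n <= p)%N -> C n `<=` C p.
  move=> /subnK <-; elim: (p - n)%N => [//|k IHk] x /IHk; exact: Cincr.
pose U := @Ideal R [set x | exists n, C n x]
  (ex_intro _ 0%N (ideal_0 (C 0%N)))
  ltac:(by move=> x y [n nx] [p py]; exists (maxn n p); apply: ideal_add;
    [exact: (Cmono n _ (leq_maxl _ _))|exact: (Cmono p _ (leq_maxr _ _))])
  ltac:(by move=> a x [n nx]; exists n; exact: ideal_mul).
have [s Us] := R_noetherian U.
have [N sN] : exists N, forall x, x \in s -> C N x.
  have : forall x, x \in s -> U x by move=> x xs; rewrite Us; exact: sub_gen.
  elim: (s) => [|x t IHt] tU; first by exists 0%N.
  have [|N tN] := IHt; first by move=> y yt; apply: tU; rewrite inE yt orbT.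
  have [n Cx] := tU x (mem_head _ _); exists (maxn n N) => y.
  rewrite inE => /orP[/eqP ->|/tN]; first exact: (Cmono n _ (leq_maxl _ _)).
  exact: (Cmono N _ (leq_maxr _ _)).
exists N => n x nx; have : U x by exists n.
by rewrite Us; apply: gen_sub => y; exact: sN.
Qed.

(** Without a maximal member above [I], choice would build a strictly increasing chain, against
    [noetherian_acc]. *)
Lemma noetherian_maximal (F : ideal R -> Prop) I : F I ->
  exists2 M, F M & I `<=` M /\ forall K, F K -> M `<=` K -> K `<=` M.
Proof.
move=> FI; pose F' (K : ideal R) := F K /\ I `<=` K.
apply: contrapT => nomax.
have grow (K : {K | F' K}) : exists K' : {K | F' K},
    sval K `<=` sval K' /\ ~ (sval K' `<=` sval K).
  case: K => K [FK IK] /=; apply: contrapT => nogrow; apply: nomax.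
  exists K => //; split=> // K' FK' KK'; apply: contrapT => nK'K.
  apply: nogrow.
  have FK'' : F' K' by split=> //; exact: subset_trans KK'.
  by exists (exist _ K' FK'').
have [next nextP] := choice grow.
have FI' : F' I by split.
pose C n : ideal R := sval (iter n next (exist _ I FI')).
have [N CN] : exists N, forall n, C n `<=` C N.
  by apply: noetherian_acc => n; case: (nextP (iter n next (exist _ I FI'))).
by case: (nextP (iter N next (exist _ I FI'))) => _; apply; exact: (CN N.+1).
Qed.

Lemma saturation_colon_pow I m :
  exists N, saturation I m = colon I (pow_ideal m N) :> set R.
Proof.
have [|N CN] := @noetherian_acc (fun n => colon I (pow_ideal m n)).
  by move=> n; exact: colon_pow_mono.
exists N; rewrite eqEsubset; split=> [f [n _]|f]; first exact: CN.
by exists N.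
Qed.

(** Apply [annihilated_multiple] to a finite generating set of [m]. The result is a nonzero socle
    element modulo [L]; both the uniqueness of [J] and the antichain property rest on it. *)
Lemma colon_multiple L m f : ~ L f ->
  (forall x, m x -> exists n, L (f * x ^+ n)) ->
  exists2 a, ~ L (a * f) & colon L m (a * f).
Proof.
move=> Lf powL; have [s ms] := R_noetherian m.
have [|a Laf aL] := annihilated_multiple (s := s) Lf.
  by move=> x xs; apply: powL; rewrite ms; exact: sub_gen.
by exists a => // x; rewrite ms; exact: colon_gen.
Qed.

Lemma colon_pow_stable J m n : colon J m = J :> set R ->
  colon J (pow_ideal m n) = J :> set R.
Proof.
move=> Jm; elim: n => [|n IHn]; first exact: colon_pow0.
rewrite colon_powS eqEsubset; split; last first.
  by move=> f Jf; apply: sub_colon; rewrite IHn.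
by move=> f fm; rewrite -Jm => x /fm; rewrite IHn.
Qed.

(** If some [f] in [J] lay outside the saturation, so would a multiple of [f] that [m] sends into
    the saturation; but the saturation is stable under one more colon by [m]. The other inclusion
    follows from [(J : m^n) = J]. *)
Lemma saturation_of_meet I J H m : radical H = m ->
  I = J `&` H :> set R -> colon J m = J :> set R -> J = saturation I m :> set R.
Proof.
move=> Hm IJH Jm; rewrite eqEsubset; split; last first.
  move=> f [n _ fI]; rewrite -(colon_pow_stable n Jm).
  by apply: colon_mono fI; rewrite IJH => ? [].
move=> f Jf; have [N satN] := saturation_colon_pow I m.
rewrite satN; apply: contrapT => Lf.
have [|a Laf aL] := @colon_multiple _ m f Lf.
  move=> x; rewrite -Hm => -[n Hxn]; exists n.
  apply: sub_colon; rewrite IJH; split; first exact: ideal_mulr.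
  exact: ideal_mul.
apply: Laf; rewrite -satN; exists N.+1 => //.
by rewrite colon_powS.
Qed.

End Noetherian.
End IdealTheory.

(** * The natural map between the colon quotients *)

Section NaturalMap.
Variables (R : comNzRingType) (m I H : ideal R).
Hypothesis IH : I `<=` H.

Lemma colon_lift_subproof (v : ideal_module (colon I m)) :
  val v \in ideal_pred (colon H m).
Proof.
by apply/asboolP; apply: (colon_mono IH); apply/asboolP; exact: valP v.
Qed.

Definition colon_lift (v : ideal_module (colon I m)) : ideal_module (colon H m) :=
  exist _ (val v) (colon_lift_subproof v).

Definition natural_map (q : iquot (colon I m) I) : iquot (colon H m) H :=
  iclass H (colon_lift (repr (q : Quotient.quot (trace_pred I)))).

(** Representatives of one class differ by an element of [I], hence of [H], so the choice made by
    [repr] is immaterial. *)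
Lemma natural_mapE v : natural_map (iclass I v) = iclass H (colon_lift v).
Proof.
have /iclassP : iclass I (repr (iclass I v : Quotient.quot _)) = iclass I v.
  by rewrite /iclass generic_quotient.reprK.
move=> /asboolP vI; apply/iclassP; apply/asboolP.
exact: IH.
Qed.

Lemma natural_map_linear : linear natural_map.
Proof.
move=> a p q; have [v ->] := iclass_surj p; have [w ->] := iclass_surj q.
have -> : a *: iclass I v + iclass I w = iclass I (a *: v + w).
  by rewrite iclassD -iclassZ.
rewrite !natural_mapE.
have -> : colon_lift (a *: v + w) = a *: colon_lift v + colon_lift w.
  by apply: val_inj.
by rewrite iclassD -iclassZ.
Qed.

HB.instance Definition _ :=
  GRing.isLinear.Build R (iquot (colon I m) I) (iquot (colon H m) H) *:%R
    natural_map natural_map_linear.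
End NaturalMap.

Lemma injective_surjective_bijective (T U : Type) (u : T -> U) :
  injective u -> (forall y, exists x, u x = y) -> bijective u.
Proof.
move=> u_inj /choice[v vK]; exists v => // x.
by apply: u_inj; rewrite vK.
Qed.

(** The last two hypotheses are injectivity and surjectivity of the natural map, expressed on
    elements of [R] instead of classes. *)
Lemma natural_isoI (R : comNzRingType) (m I H : ideal R) :
  I `<=` H -> (forall f, colon I m f -> H f -> I f) ->
  (forall f, colon H m f -> exists2 g, colon I m g & H (f - g)) ->
  natural_iso m I H.
Proof.
move=> IH inj surj; exists (natural_map (m := m) IH); split.
  by move=> f; exists (colon_lift IH f); split=> //; exact: natural_mapE.
apply: injective_surjective_bijective => [p q|q].
  have [v ->] := iclass_surj p; have [w ->] := iclass_surj q.
  rewrite /= !natural_mapE => /iclassP /asboolP vwH.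
  apply/iclassP/asboolP; apply: inj => //.
  by have /asboolP := valP (v - w).
have [v ->] := iclass_surj q.
have /asboolP /surj[g gIm vgH] := valP v.
have gP : g \in ideal_pred (colon I m) by apply/asboolP.
exists (iclass I (exist _ g gP)); rewrite /= natural_mapE.
apply/iclassP/asboolP => /=.
by rewrite -opprB; exact: idealN.
Qed.

(** The form in which the isomorphism enters the antichain argument. *)
Lemma natural_iso_surj (R : comNzRingType) (m I H : ideal R) (f : R) :
  natural_iso m I H -> colon H m f -> exists2 g, colon I m g & H (f - g).
Proof.
move=> [u [uE [v _ vK]]] fHm.
have fP : f \in ideal_pred (colon H m) by apply/asboolP.
have [w vw] := iclass_surj (v (iclass H (exist _ f fP))).
exists (val w); first by have /asboolP := valP w.
have [w' [w'E]] := uE w; rewrite -vw vK => /iclassP /asboolP /=.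
by rewrite -w'E.
Qed.

(** * Homogeneous components and homogeneous ideals *)

Section Grading.
Variables (G : zmodType) (R : comNzRingType) (A : grading G R).
Implicit Types (g h : G) (x y z f : R) (I J K H m : ideal R).

Lemma sum_supp (s u : seq G) (c : G -> R) : uniq s -> uniq u -> {subset s <= u} ->
  \sum_(g <- u) (if g \in s then c g else 0) = \sum_(g <- s) c g.
Proof.
move=> us uu su; rewrite -big_mkcond -big_filter; apply: perm_big.
apply: uniq_perm; rewrite ?filter_uniq // => g.
by rewrite mem_filter; case: (boolP (g \in s)) => //= /su.
Qed.

(** On the union of both supports the differences [d g] decompose 0, so [grading_indep] kills
    them. *)
Lemma decomposition_unique (s t : seq G) (c e : G -> R) :
  uniq s -> uniq t -> (forall g, A g (c g)) -> (forall g, A g (e g)) ->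
  \sum_(g <- s) c g = \sum_(g <- t) e g ->
  forall g, (if g \in s then c g else 0) = (if g \in t then e g else 0).
Proof.
move=> us ut Ac Ae ce g; pose u := undup (s ++ t).
have uu : uniq u by exact: undup_uniq.
pose d g := (if g \in s then c g else 0) - (if g \in t then e g else 0).
have Ad h : A h (d h).
  by apply: piece_sub; case: ifP => _ //; exact: piece_0.
have d0 : \sum_(h <- u) d h = 0.
  rewrite big_split /= sumrN !sum_supp ?ce ?subrr //.
    by move=> h ht; rewrite mem_undup mem_cat ht orbT.
  by move=> h hs; rewrite mem_undup mem_cat hs.
have [gu|] := boolP (g \in u).
  by apply/eqP; rewrite -subr_eq0; apply/eqP; exact: (grading_indep uu Ad d0).
by rewrite mem_undup mem_cat negb_or => /andP[/negbTE -> /negbTE ->].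
Qed.

(** The family given by [grading_span] may be nonzero outside [s]; resetting it to 0 there makes it
    depend on [x] alone. *)
Lemma component_exists x : exists c : G -> R, (forall g, A g (c g)) /\
  exists s, [/\ uniq s, x = \sum_(g <- s) c g & forall g, g \notin s -> c g = 0].
Proof.
have [s [c [us Ac xE]]] := grading_span A x.
exists (fun g => if g \in s then c g else 0); split.
  by move=> g; case: ifP => // _; exact: piece_0.
exists s; split=> // [|g /negbTE -> //].
by rewrite sum_supp.
Qed.

Definition component g x : R := sval (cid (component_exists x)) g.

Lemma component_piece g x : A g (component g x).
Proof. by rewrite /component; case: cid => c [] /=. Qed.

Lemma component_homogeneous g x : homogeneous A (component g x).
Proof. by exists g => //; exact: component_piece. Qed.

Lemma component_sum x : exists2 s, uniq s & x = \sum_(g <- s) component g x.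
Proof. by rewrite /component; case: cid => c [_ [s []]] /=; exists s. Qed.

Lemma component_unique (s : seq G) (c : G -> R) : uniq s -> (forall g, A g (c g)) ->
  forall g, component g (\sum_(h <- s) c h) = if g \in s then c g else 0.
Proof.
move=> us Ac g; rewrite /component; case: cid => e [Ae [t [ut ceE e0]]] /=.
rewrite (decomposition_unique us ut Ac Ae ceE).
by case: ifPn => // /e0.
Qed.

Lemma component_id g h x : A h x -> component g x = if g == h then x else 0.
Proof.
move=> Ax; pose c h' := if h' == h then x else 0.
have Ac h' : A h' (c h').
  by rewrite /c; case: eqP => [->|_] //; exact: piece_0.
have := @component_unique [:: h] c isT Ac g.
by rewrite big_seq1 inE /c eqxx; case: eqP.
Qed.

Lemma component0 g : component g 0 = 0.
Proof. by rewrite (component_id g (piece_0 A g)) eqxx. Qed.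

Lemma componentB g x y : component g (x - y) = component g x - component g y.
Proof.
have [cx [Acx [s [us xE cx0]]]] := component_exists x.
have [cy [Acy [t [ut yE cy0]]]] := component_exists y.
pose u := undup (s ++ t); have uu : uniq u by exact: undup_uniq.
have ext (r : seq G) (c : G -> R) : uniq r -> (forall g, g \notin r -> c g = 0) ->
    {subset r <= u} -> \sum_(h <- r) c h = \sum_(h <- u) c h.
  move=> ur c0 ru; rewrite -(sum_supp c ur uu ru); apply: eq_bigr => h _.
  by case: ifPn => // /c0.
have su : {subset s <= u} by move=> h hs; rewrite mem_undup mem_cat hs.
have tu : {subset t <= u} by move=> h ht; rewrite mem_undup mem_cat ht orbT.
have Ad h : A h (cx h - cy h) by exact: piece_sub.
rewrite xE yE (ext s) // (ext t) // -sumrB.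
rewrite (component_unique uu Ad) !(component_unique uu) //.
by case: ifP => // _; rewrite subrr.
Qed.

HB.instance Definition _ g :=
  GRing.isZmodMorphism.Build R R (component g) (componentB g).

(** Each component of [a] is shifted by [h], so only the one of degree [g - h] reaches degree
    [g]. *)
Lemma componentM g h a x : A h x ->
  component g (a * x) = component (g - h) a * x.
Proof.
move=> Ax; have [s us aE] := component_sum a.
rewrite {1}aE mulr_suml raddf_sum /=.
have -> : component (g - h) a = component (g - h) (\sum_(k <- s) component k a).
  by rewrite -aE.
rewrite raddf_sum mulr_suml; apply: eq_bigr => k _ /=.
have Ak := component_piece k a.
rewrite (component_id g (piece_mul Ak Ax)) (component_id (g - h) Ak).
by rewrite subr_eq; case: eqP; rewrite ?mul0r.
Qed.

Definition component_closed I := forall g x, I x -> I (component g x).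

(** The elements all of whose components lie in [I] form an ideal [K] containing the homogeneous
    generators. Conversely, the homogeneous elements of a component-closed [I] generate it. *)
Lemma homogeneous_idealP I : homogeneous_ideal A I <-> component_closed I.
Proof.
split=> [[S Sh IS] g x|Icl]; last first.
  exists [set x | I x /\ homogeneous A x]; first by move=> x [].
  rewrite eqEsubset; split; last by apply: gen_sub => x [].
  move=> x Ix; have [s _ ->] := component_sum x.
  apply: ideal_sum => g _; apply: sub_gen; split; first exact: Icl.
  exact: component_homogeneous.
pose K := @Ideal R [set x | forall g, I (component g x)]
  ltac:(by move=> h; rewrite component0; exact: ideal_0)
  ltac:(by move=> y z Iy Iz h; rewrite raddfD; apply: ideal_add; [exact: Iy|exact: Iz])
  ltac:(by move=> a y Iy h; have [s _ ->] := component_sum y;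
    rewrite mulr_sumr raddf_sum; apply: ideal_sum => k _ /=;
    rewrite (componentM _ _ (component_piece k y)); apply: ideal_mul; exact: Iy).
suff IK : I `<=` K by move=> /IK.
rewrite IS; apply: gen_sub => y Sy h; have [k _ Ay] := Sh y Sy.
rewrite (component_id h Ay); case: ifP => _; last exact: ideal_0.
by rewrite IS; exact: sub_gen.
Qed.

(** It suffices to test against homogeneous generators of [m], and there a component of [f] times
    the generator is a component of the product. *)
Lemma component_closed_colon I m : component_closed I -> homogeneous_ideal A m ->
  component_closed (colon I m).
Proof.
move=> Icl [S Sh mS] g f fm; rewrite /= mS; apply: colon_gen => x Sx.
have [h _ Ax] := Sh x Sx.
have -> : component g f * x = component (g + h) (f * x).
  by rewrite (componentM _ _ Ax) addrK.
by apply: Icl; apply: fm; rewrite mS; exact: sub_gen.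
Qed.

Lemma component_closed_colon_pow I m n : component_closed I ->
  homogeneous_ideal A m -> component_closed (colon I (pow_ideal m n)).
Proof.
move=> Icl mh; elim: n => [|n IHn] g f.
  by rewrite colon_pow0; exact: Icl.
by rewrite colon_powS; exact: component_closed_colon.
Qed.

Lemma component_closed_add_elt I h z : component_closed I -> A h z ->
  component_closed (add_elt I z).
Proof.
move=> Icl Az g _ [y [a [Iy ->]]].
exists (component g y), (component (g - h) a); split; first exact: Icl.
by rewrite raddfD /= (componentM _ _ Az).
Qed.

(** The exponent starts at 1 because the record [grading] does not itself state that 1 is
    homogeneous. *)
Lemma homogeneousX x n : homogeneous A x -> homogeneous A (x ^+ n.+1).
Proof.
move=> [g _ Ax]; elim: n => [|n [k _ Axn]]; first by exists g.
by exists (g + k) => //; rewrite exprS; exact: piece_mul.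
Qed.

(** * Regularity and primary ideals over an ordered group of degrees *)

Section Ordered.
(** The strictly positive cone of a translation-invariant total order: [pos (a - g)] reads as
    [g < a]. *)
Variable pos : G -> Prop.
Hypothesis pos0 : ~ pos 0.
Hypothesis posD : forall g h, pos g -> pos h -> pos (g + h).
Hypothesis pos_total : forall g, [\/ pos g, g = 0 | pos (- g)].

Lemma seq_max (s : seq G) : s != [::] ->
  exists2 a, a \in s & forall g, g \in s -> g = a \/ pos (a - g).
Proof.
elim: s => // b s IHs _; have [->|/IHs[a as_ amax]] := eqVneq s [::].
  by exists b => [|g]; rewrite inE ?eqxx // => /eqP; left.
have [pab|ab|] := pos_total (a - b).
- exists a => [|g]; rewrite inE ?as_ ?orbT // => /orP[/eqP ->|/amax //]; by right.
- exists a => [|g]; rewrite inE ?as_ ?orbT // => /orP[/eqP ->|/amax //].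
  by left; apply/esym/eqP; rewrite -subr_eq0 ab.
rewrite opprB => pba; exists b => [|g]; rewrite inE ?eqxx //.
case/orP => [/eqP ->|/amax[->|pag]]; [by left|by right|right].
by have := posD pba pag; rewrite addrA subrK.
Qed.

(* The product of the top-degree terms of [x] modulo [K] and of [y] is a
   component of the product. *)
Lemma regular_mod_homogeneous K x (s : seq G) (c : G -> R) :
  component_closed K -> s != [::] -> uniq s -> (forall g, A g (c g)) ->
  (forall g, g \in s -> is_unit (c g)) ->
  K (x * \sum_(g <- s) c g) -> K x.
Proof.
move=> Kcl s0 us Ac cu Kxy; have [t ut xE] := component_sum x.
(* Discarding the components in [K] leaves a representative [x'] of [x] modulo [K] whose top term,
   if any, is outside [K]. *)
pose t' := [seq g <- t | ~~ `[< K (component g x) >]].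
pose x' := \sum_(g <- t') component g x.
have Kxx' : K (x - x').
  rewrite {1}xE /x' big_filter (bigID (fun g => `[< K (component g x) >])) /= addrK.
  by apply: ideal_sum => g /asboolP.
suff Kx' : K x' by rewrite -[x](subrK x'); exact: ideal_add.
have [t'0|t'0] := eqVneq t' [::]; first by rewrite /x' t'0 big_nil; exact: ideal_0.
have [a at' amax] := seq_max t'0; have [b bs bmax] := seq_max s0.
have ut' : uniq t' by exact: filter_uniq.
have : K (component (a + b) (x' * \sum_(g <- s) c g)).
  apply: Kcl; rewrite -[x'](subKr x) mulrBl; apply: idealB => //.
  exact: ideal_mulr.
(* If both degrees were smaller than the top ones, 0 would be a sum of two positive degrees; if one
   is equal, cancellation settles the other. *)
have top h g : h \in t' -> g \in s -> a + b = h + g -> h = a /\ g = b.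
  move=> /amax[->|pah] /bmax[->|pbg] //.
  - by move=> /addrI ab; split.
  - by move=> /addIr ab; split.
  - move=> abE; case: pos0.
    have := posD pah pbg; suff -> : a - h + (b - g) = 0 by [].
    by rewrite addrACA -opprD abE subrr.
have -> : component (a + b) (x' * \sum_(g <- s) c g) = component a x * c b.
  rewrite /x' mulr_suml raddf_sum (bigD1_seq a) //= mulr_sumr raddf_sum.
  rewrite (bigD1_seq b) //= (component_id _ (piece_mul (component_piece a x) (Ac b))).
  rewrite eqxx big_seq_cond big1 ?addr0 => [|g /andP[gs gb]]; last first.
    rewrite (component_id _ (piece_mul (component_piece a x) (Ac g))).
    by case: eqP => // /(top _ _ at' gs)[_ gE]; rewrite gE eqxx in gb.
  rewrite big_seq_cond big1 ?addr0 // => h /andP[ht' ha].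
  rewrite mulr_sumr raddf_sum big_seq big1 // => g gs /=.
  rewrite (component_id _ (piece_mul (component_piece h x) (Ac g))).
  by case: eqP => // /(top _ _ ht' gs)[hE _]; rewrite hE eqxx in ha.
have [d cd] := cu b bs => Kab.
have Ka : K (component a x).
  by rewrite -[component a x]mulr1 -cd mulrA; exact: ideal_mulr.
by move: at'; rewrite mem_filter => /andP[/asboolP].
Qed.

Variable m : ideal R.
Hypothesis m_local : is_gr_local A m.

Lemma gr_local_homogeneous : homogeneous_ideal A m.
Proof.
by case: m_local => mE _; exists [set x | homogeneous A x /\ ~ is_unit x] => // x [].
Qed.

Lemma gr_local_unit x : homogeneous A x -> ~ m x -> is_unit x.
Proof.
move=> xh mx; apply: contrapT => xu; apply: mx.
by case: m_local => -> _; exact: sub_gen.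
Qed.

(** A component outside [m] would be a unit and put 1 in [K]. Thus [m] is the largest proper
    homogeneous ideal. *)
Lemma gr_local_sub K : component_closed K -> ~ K 1 -> K `<=` m.
Proof.
move=> Kcl K1 x Kx; have [s _ ->] := component_sum x.
apply: ideal_sum => g _; apply: contrapT => mg.
have [|d cd] := gr_local_unit _ mg; first exact: component_homogeneous.
by apply: K1; rewrite -cd; apply: ideal_mulr; exact: Kcl.
Qed.

(** Homogeneous elements suffice, since [m] contains the components of its elements and a radical is
    closed under sums. *)
Lemma gr_local_radical K : (forall x, homogeneous A x -> m x -> radical K x) ->
  m `<=` radical K.
Proof.
move=> Kpow x mx; have [s _ ->] := component_sum x.
apply: (ideal_sum (I := radical_ideal K)) => g _.
apply: Kpow; first exact: component_homogeneous.
by have /homogeneous_idealP := gr_local_homogeneous; apply.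
Qed.

(* [y] is the sum of an element of [m], nilpotent modulo [K], and of a nonempty
   sum of homogeneous units, regular modulo [K]. *)
Lemma gr_local_regular K x y : component_closed K -> m `<=` radical K ->
  K (x * y) -> ~ m y -> K x.
Proof.
move=> Kcl mK Kxy my; have [s us yE] := component_sum y.
pose s' := [seq g <- s | ~~ `[< m (component g y) >]].
pose y' := \sum_(g <- s | `[< m (component g y) >]) component g y.
pose y'' := \sum_(g <- s') component g y.
have yE' : y = y' + y''.
  by rewrite {1}yE (bigID (fun g => `[< m (component g y) >])) /= /y'' big_filter.
have my' : m y' by apply: ideal_sum => g /asboolP.
have reg z : K (z * y'') -> K z.
  apply: regular_mod_homogeneous => //.
  - apply/eqP => s'0; apply: my; rewrite yE' /y'' s'0 big_nil addr0; exact: my'.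
  - exact: filter_uniq.
  - by move=> g; exact: component_piece.
  - move=> g; rewrite mem_filter => /andP[/asboolP mg _].
    by apply: gr_local_unit => //; exact: component_homogeneous.
have [k Kyk] := mK _ my'.
(* Since [x * y] lies in [K], multiplying [x] by [y''] amounts modulo [K] to multiplying it by
   [- y'], which is nilpotent. *)
have step j : K (x * y'' ^+ j - x * (- y') ^+ j).
  elim: j => [|j IHj]; first by rewrite !expr0 subrr; exact: ideal_0.
  have -> : x * y'' ^+ j.+1 - x * (- y') ^+ j.+1 =
      y'' * (x * y'' ^+ j - x * (- y') ^+ j) + (- y') ^+ j * (x * y).
    by rewrite yE' !exprS; ring.
  by apply: ideal_add; exact: ideal_mul.
have : K (x * y'' ^+ k).
  rewrite -[X in K X](subrK (x * (- y') ^+ k)); apply: ideal_add => //.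
  by rewrite exprNn; apply: ideal_mul; exact: ideal_mul.
by elim: k {Kyk} => [|k IHk]; rewrite ?mulr1 // exprSr mulrA => /reg.
Qed.

Lemma gr_local_primary K : component_closed K -> ~ K 1 -> m `<=` radical K ->
  primary_to m K.
Proof.
move=> Kcl K1 mK.
have radE : radical K = m.
  rewrite eqEsubset; split=> // x [n Kxn]; apply: contrapT => mx.
  have mcl : component_closed m.
    by apply/homogeneous_idealP; exact: gr_local_homogeneous.
  (* This allows [gr_local_regular] to be used with [m] in place of [K], where it says that [m] is
     prime. *)
  have mm : m `<=` radical m by move=> z mz; exists 1%N.
  have: m (x ^+ n) by exact: gr_local_sub Kxn.
  elim: n {Kxn} => [|n IHn]; first by case: m_local.
  by rewrite exprSr => mxn; apply: IHn; exact: gr_local_regular mxn mx.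
split=> //; split=> // x y Kxy; rewrite radE.
by have [my|my] := pselect (m y); [right|left; exact: gr_local_regular Kxy my].
Qed.

End Ordered.
End Grading.

(** * Uniqueness of [J] and the antichain property *)

Section Decomposition.
Variable R : comNzRingType.
Implicit Types (I J K H m : ideal R) (x y z f : R).

Lemma good_pair_saturation (P : ideal R -> Prop) m I J H : noetherian R ->
  good_pair P m I J H -> J = saturation I m :> set R.
Proof. by move=> RN [_ [[_ Hm] IJH Jm _]]; exact: (saturation_of_meet RN Hm). Qed.

Lemma good_pair_antichain (P : ideal R -> Prop) m I J1 H1 J2 H2 : noetherian R ->
  good_pair P m I J1 H1 -> good_pair P m I J2 H2 -> H1 `<=` H2 ->
  H1 = H2 :> set R.
Proof.
move=> RN gp1 [_ [_ IJH2 J2m _]] H12; case: gp1 => _ [[_ H1m] IJH1 _ iso1].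
rewrite eqEsubset; split=> // f H2f; apply: contrapT => H1f.
(* [f] need not lie in [(H1 : m)], but some multiple [a * f] outside [H1] does, and it stays in
   [H2]. *)
have [|a H1af aH1m] := colon_multiple RN (m := m) H1f.
  move=> x; rewrite -H1m => -[n H1xn]; exists n; exact: ideal_mul.
have [g gIm H1g] := natural_iso_surj iso1 aH1m.
have H2g : H2 g.
  by rewrite -[g](subKr (a * f)); apply: idealB; [exact: ideal_mul|exact: H12].
have J2g : J2 g.
  by rewrite -J2m; apply: colon_mono gIm; rewrite IJH2 => ? [].
have : I g by rewrite IJH2.
rewrite IJH1 => -[_ H1g']; apply: H1af.
by rewrite -[a * f](subrK g); exact: ideal_add.
Qed.

(** Serves to pass from the homogeneous ideals of the trivial grading to all ideals. *)
Lemma good_decomposition_ext (P Q : ideal R -> Prop) m I :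
  (forall K, P K <-> Q K) -> good_decomposition P m I -> good_decomposition Q m I.
Proof.
by move=> PQ; suff -> : Q = P by []; apply/funext => K; apply/propext; split=> /PQ.
Qed.

(** * Existence of the decomposition in the graded case *)

Section GradedDecomposition.
Variables (G : zmodType) (A : grading G R) (pos : G -> Prop).
Hypothesis pos0 : ~ pos 0.
Hypothesis posD : forall g h, pos g -> pos h -> pos (g + h).
Hypothesis pos_total : forall g, [\/ pos g, g = 0 | pos (- g)].
Variables m I : ideal R.
Hypothesis R_noetherian : noetherian R.
Hypothesis m_local : is_gr_local A m.
Hypothesis I_homogeneous : homogeneous_ideal A I.
Hypothesis I_colon : colon I m <> I :> set R.

Let Icl : component_closed A I.
Proof. exact/homogeneous_idealP. Qed.

Section Maximal.
Variables (J H : ideal R) (N : nat).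
Hypothesis J_def : J = colon I (pow_ideal m N).
Hypothesis J_stable : colon J m = J :> set R.
Hypothesis Hcl : component_closed A H.
Hypothesis HJ : H `&` J `<=` I.
Hypothesis IH : I `<=` H.
Hypothesis H_max : forall K, component_closed A K -> K `&` J `<=` I ->
  H `<=` K -> K `<=` H.

Let IJ : I `<=` J.
Proof. by rewrite J_def; exact: sub_colon. Qed.

Let ImJ : colon I m `<=` J.
Proof. by rewrite -J_stable; exact: colon_mono. Qed.

Let Jcl : component_closed A J.
Proof.
by rewrite J_def; apply: component_closed_colon_pow => //; exact: gr_local_homogeneous.
Qed.

(** Otherwise [J] would lie in [I]; as [(I : m)] lies in [J], this contradicts [I_colon]. *)
Let notH1 : ~ H 1.
Proof.
move=> H1; apply: I_colon; rewrite eqEsubset; split; last exact: sub_colon.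
move=> f /ImJ Jf; apply: HJ; split=> //.
by rewrite -[f]mulr1; exact: ideal_mul.
Qed.

(* Noether's argument: once the chain [(H : x^n)] is stationary at [n], the
   intersection of [H + (x^(n + N))] with [J] lies in [H]. *)
Lemma maximal_radical x : homogeneous A x -> m x -> radical H x.
Proof.
move=> xh mx.
have [|n Hn] := noetherian_acc R_noetherian (C := fun n => colon_elt H (x ^+ n)).
  by move=> k f /= Hf; rewrite exprSr mulrA; apply: ideal_mulr; exact: Hf.
have [d _ Axd] : homogeneous A (x ^+ (n + N).+1) by exact: homogeneousX.
exists (n + N).+1; apply: (H_max (component_closed_add_elt Hcl Axd)).
- move=> _ [[h [a [Hh ->]]] Jf]; apply: HJ; split=> //.
  apply: ideal_add => //.
  (* [x ^+ N] lies in [m^N], which sends [J] into [I]. *)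
  have IxN : I ((h + a * x ^+ (n + N).+1) * x ^+ N).
    by move: Jf; rewrite J_def; apply; exact: pow_ideal_exp.
  have : colon_elt H (x ^+ ((n + N).+1 + N)) a.
    have -> : colon_elt H (x ^+ ((n + N).+1 + N)) a =
        H ((h + a * x ^+ (n + N).+1) * x ^+ N - h * x ^+ N).
      by rewrite /= exprD; congr (ideal_set H _); ring.
    by apply: idealB; [exact: IH|exact: ideal_mulr].
  (* Stationarity lowers the exponent to [n]: already [a * x ^+ n] lies in [H]. *)
  move=> /Hn /= Hax; rewrite -addnS exprD mulrA; exact: ideal_mulr.
- exact: sub_add_elt.
- exact: mem_add_elt.
Qed.

Lemma maximal_colon f : colon H m f -> exists2 g, colon I m g & H (f - g).
Proof.
move=> fHm; have [s _ fE] := component_sum A f.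
pose Q f := exists2 g, colon I m g & H (f - g).
(* [Q] is additive, so the components of [f] suffice; they remain in [(H : m)] because that ideal is
   homogeneous. *)
have : forall g, Q (component A g f); last first.
  move=> Qf; rewrite -/(Q f) fE; apply: big_ind => //.
    by exists 0; [exact: ideal_0|rewrite subrr; exact: ideal_0].
  move=> x y [gx gxm Hx] [gy gym Hy]; exists (gx + gy); first exact: ideal_add.
  by rewrite opprD addrACA; exact: ideal_add.
move=> d; have := component_piece A d f.
have : colon H m (component A d f).
  by apply: component_closed_colon => //; exact: gr_local_homogeneous.
move: (component A d f) => {fE s fHm}f fHm Af.
have [Hf|Hf] := pselect (H f).
  by exists 0; [exact: ideal_0|rewrite subr0].
have : ~ (add_elt H f `&` J `<=` I).
  move=> KJ; apply: Hf; apply: (H_max (component_closed_add_elt Hcl Af) KJ).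
    exact: sub_add_elt.
  exact: mem_add_elt.
move=> /existsNP[z /not_implyP[[[h [a [Hh zE]]] Jz] Iz]].
have [e Ize] : exists e, ~ I (component A e z).
  apply/existsNP => Izs; apply: Iz; have [t _ ->] := component_sum A z.
  exact: ideal_sum.
have zeE : component A e z = component A e h + component A (e - d) a * f.
  by rewrite zE raddfD /= (componentM _ _ Af).
(* Were the coefficient of [f] in [m], its product with [f] would lie in [H], and the component of
   [z] would lie in both [H] and [J], hence in [I]. *)
have [|c bc] := gr_local_unit m_local (component_homogeneous A (e - d) a).
  move=> mb; apply: Ize; apply: HJ; split; last exact: Jcl.
  rewrite zeE; apply: ideal_add; first exact: Hcl.
  by rewrite mulrC; exact: fHm.
pose h' := c * component A e h.
have Hh' : H h' by apply: ideal_mul; exact: Hcl.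
(* Dividing the component of [z] by its unit coefficient of [f] yields exactly [f + h']. *)
have Jg : J (f + h').
  have -> : f + h' = c * component A e z.
    by rewrite zeE mulrDr mulrA (mulrC c (component A (e - d) a)) bc mul1r addrC.
  by apply: ideal_mul; exact: Jcl.
exists (f + h'); last by rewrite opprD addNKr; exact: idealN.
(* A multiple of [f + h'] by an element of [m] lies in [H], as [f] is in [(H : m)] and [h'] in [H],
   and also in [J]. *)
move=> y my; apply: HJ; split; last exact: ideal_mulr.
by rewrite mulrDl; apply: ideal_add; [exact: fHm|exact: ideal_mulr].
Qed.

Lemma maximal_good_pair : good_pair (homogeneous_ideal A) m I J H.
Proof.
split; first by split; exact/homogeneous_idealP.
split=> //.
- apply: (gr_local_primary pos0 posD pos_total m_local) => //.
  apply: (gr_local_radical m_local); exact: maximal_radical.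
- rewrite eqEsubset; split; first by move=> x Ix; split; [exact: IJ|exact: IH].
  by move=> x [Jx Hx]; exact: HJ.
- apply: natural_isoI => //; last exact: maximal_colon.
  by move=> f /ImJ Jf Hf; exact: HJ.
Qed.

End Maximal.

Lemma graded_good_pair_exists : exists J H, good_pair (homogeneous_ideal A) m I J H.
Proof.
have [N satN] := saturation_colon_pow R_noetherian I m.
pose J := colon I (pow_ideal m N).
(* [(J : m)] is [(I : m^(N+1))], which lies in the saturation, that is, in [J]. *)
have J_stable : colon J m = J :> set R.
  rewrite eqEsubset; split; last exact: sub_colon.
  by rewrite -colon_powS -satN => f fN; exists N.+1.
have [|H [Hcl HJ] [IH H_max]] := noetherian_maximal R_noetherian
    (F := fun K => component_closed A K /\ K `&` J `<=` I) (I := I).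
  by split=> // x [].
exists J, H; apply: (@maximal_good_pair J H N) => //.
by move=> K Kcl KJ; exact: H_max.
Qed.

Lemma graded_good_decomposition : good_decomposition (homogeneous_ideal A) m I.
Proof.
split; first exact: graded_good_pair_exists.
- by move=> J H; exact: good_pair_saturation.
- by move=> J1 H1 J2 H2; exact: good_pair_antichain.
Qed.

End GradedDecomposition.

(** * The grading concentrated in degree 0, for the local case *)

Section TrivialGrading.

Definition trivial_piece (g : int) : set R := [set x | g = 0 \/ x = 0].

Lemma trivial_piece_0 g : trivial_piece g 0.
Proof. by right. Qed.

Lemma trivial_piece_sub g x y :
  trivial_piece g x -> trivial_piece g y -> trivial_piece g (x - y).
Proof. by move=> [g0 _|-> [g0|->]]; [left|left|right; rewrite subrr]. Qed.

Lemma trivial_piece_mul g h x y :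
  trivial_piece g x -> trivial_piece h y -> trivial_piece (g + h) (x * y).
Proof.
by move=> [->|->] [->|->]; [left; rewrite addr0|right; rewrite mulr0
  |right; rewrite mul0r|right; rewrite mul0r].
Qed.

Lemma trivial_grading_span x : exists (s : seq int) (c : int -> R),
  [/\ uniq s, (forall g, trivial_piece g (c g)) & x = \sum_(g <- s) c g].
Proof.
exists [:: 0], (fun g => if g == 0 then x else 0); split=> //.
  by move=> g; case: eqP; [left|right].
by rewrite big_seq1 eqxx.
Qed.

Lemma trivial_grading_indep (s : seq int) (c : int -> R) :
  uniq s -> (forall g, trivial_piece g (c g)) -> \sum_(g <- s) c g = 0 ->
  forall g, g \in s -> c g = 0.
Proof.
move=> us Ac cs g gs; have [g0|//] := Ac g.
move: cs; rewrite (bigD1_seq g) //= big1 ?addr0 // => h hg.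
by have [h0|//] := Ac h; rewrite h0 g0 eqxx in hg.
Qed.

Definition trivial_grading : grading int R :=
  Grading trivial_piece_0 trivial_piece_sub trivial_piece_mul
    trivial_grading_span trivial_grading_indep.

Lemma trivial_homogeneous x : homogeneous trivial_grading x.
Proof. by exists 0 => //; left. Qed.

Lemma trivial_homogeneous_ideal I : homogeneous_ideal trivial_grading I.
Proof.
exists I; first by move=> x _; exact: trivial_homogeneous.
by rewrite eqEsubset; split; [exact: sub_gen|exact: gen_sub].
Qed.

(** A nonunit generates a proper ideal, which by Noetherianity lies in a maximal ideal; by
    uniqueness that ideal is [m]. So [m] consists of the nonunits, all homogeneous here. *)
Lemma is_local_gr_local m : noetherian R -> is_local m ->
  is_gr_local trivial_grading m.
Proof.
move=> RN [[m1 _] m_unique]; split=> //; rewrite eqEsubset; split.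
  move=> x mx; apply: sub_gen; split; first exact: trivial_homogeneous.
  by move=> [y xy]; apply: m1; rewrite -xy; exact: ideal_mulr.
apply: gen_sub => x [_ xu].
pose Rx := @Ideal R [set y | exists a, y = a * x]
  ltac:(by exists 0; rewrite mul0r)
  ltac:(by move=> _ _ [a ->] [b ->]; exists (a + b); rewrite mulrDl)
  ltac:(by move=> c _ [a ->]; exists (c * a); rewrite mulrA).
have [|M M1 [RxM Mmax]] := noetherian_maximal RN (F := fun K => ~ K 1) (I := Rx).
  by move=> [y xy]; apply: xu; exists y; rewrite mulrC.
have <- : M = m :> set R.
  apply: m_unique; split=> // K MK; have [|K1] := pselect (K 1); first by right.
  by left; rewrite eqEsubset; split=> //; exact: Mmax.
by apply: RxM; exists 1; rewrite mul1r.
Qed.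

End TrivialGrading.
End Decomposition.

(** * Positive cones on the integers and, lexicographically, on integer vectors *)

Lemma int_pos_total (g : int) : [\/ 0 < g, g = 0 | 0 < - g].
Proof. by rewrite oppr_gt0; case: (ltgtP g 0) => [||]; constructor. Qed.

Definition lex_pos (d : nat) (v : 'rV[int]_d) : Prop :=
  exists2 i, 0 < v 0 i & forall j : 'I_d, (j < i)%N -> v 0 j = 0.

Lemma lex_pos0 d : ~ lex_pos (0 : 'rV[int]_d).
Proof. by move=> [i]; rewrite mxE ltxx. Qed.

(** The smaller of the two leading indices is the leading index of the sum; if they agree, two
    positive entries are added. *)
Lemma lex_posD d (v w : 'rV[int]_d) : lex_pos v -> lex_pos w -> lex_pos (v + w).
Proof.
move=> [i vi v0] [k wk w0]; case: (ltngtP i k) => ik.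
- exists i => [|j ji]; first by rewrite mxE w0 // addr0.
  by rewrite mxE v0 // w0 ?addr0 //; exact: ltn_trans ik.
- exists k => [|j ji]; first by rewrite mxE v0 // add0r.
  by rewrite mxE w0 // v0 ?addr0 //; exact: ltn_trans ik.
- move/val_inj: ik => ik; subst k; exists i => [|j ji].
    by rewrite mxE addr_gt0.
  by rewrite mxE v0 // w0 // addr0.
Qed.

Lemma lex_pos_total d (v : 'rV[int]_d) : [\/ lex_pos v, v = 0 | lex_pos (- v)].
Proof.
have [->|/eqP v0] := eqVneq v 0; first by constructor 2.
have [i0 vi0] : exists i, v 0 i != 0.
  apply: contrapT => /forallNP v0'; apply: v0; apply/rowP => i.
  by rewrite mxE; apply/eqP/negPn/negP; exact: v0'.
(* The least index with a nonzero entry; the sign of that entry decides the case. *)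
case: (@arg_minnP _ i0 (fun i => v 0 i != 0) (@nat_of_ord d) vi0) => i vi imin.
have below (j : 'I_d) : (j < i)%N -> v 0 j = 0.
  by move=> ji; apply/eqP; apply: contraTT ji => /imin; rewrite -leqNgt.
have [vi_pos|v_i0|vi_neg] := int_pos_total (v 0 i).
- by constructor 1; exists i.
- by rewrite v_i0 eqxx in vi.
- by constructor 3; exists i => [|j ji]; rewrite mxE // below ?oppr0.
Qed.

Theorem theorem5p6 (R : comNzRingType) (m I : ideal R)
    (R_noetherian : noetherian R)
    (I_colon : colon I m <> I :> set R) :
  (is_local m -> good_decomposition (fun _ => True) m I) /\
  (forall A : grading int R,
     is_gr_local A m -> homogeneous_ideal A I ->
     good_decomposition (homogeneous_ideal A) m I) /\
  (forall (d : nat) (A : grading 'rV[int]_d R),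
     is_gr_local A m -> homogeneous_ideal A I ->
     good_decomposition (homogeneous_ideal A) m I).
Proof.
have int_case (A : grading int R) : is_gr_local A m -> homogeneous_ideal A I ->
    good_decomposition (homogeneous_ideal A) m I.
  move=> m_local Ih.
  apply: (@graded_good_decomposition R int A (fun g => 0 < g)) => //.
  - exact: addr_gt0.
  - exact: int_pos_total.
split; last split=> //.
- move=> m_local.
  apply: (@good_decomposition_ext _ (homogeneous_ideal (trivial_grading R))).
    by move=> K; split=> // _; exact: trivial_homogeneous_ideal.
  apply: int_case; last exact: trivial_homogeneous_ideal.
  exact: is_local_gr_local.
- move=> d A m_local Ih.
  apply: (@graded_good_decomposition R _ A (@lex_pos d)) => //.
  + exact: lex_pos0.
  + exact: lex_posD.
  + exact: lex_pos_total.
Qed.
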